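(* Let $\mathbb{F}$ be an algebraically closed field of characteristic zero and let $n,m,d,k\ge 1$ be integers. Let $V=\mathrm{Ten}(n,d)$ with set of simples $S=\{\mathbf v_1\otimes\cdots\otimes\mathbf v_d:\mathbf v_i\in\mathbb F^n\}$. For every nonzero linear map $\phi:\mathrm{Ten}(n,d)\to\mathrm{Ten}(m,k)$ (a $T_k$-rank method), its potency satisfies $$\mathrm{Pot}(\phi)\le k^d\cdot n^{\lfloor (k-1)d/k\rfloor}.$$
   Context: $\mathrm{Ten}(n,d)=\mathbb F^n\otimes\cdots\otimes\mathbb F^n$ ($d$ factors). A tensor of the form $\mathbf v_1\otimes\cdots\otimes\mathbf v_d$ is called simple (rank 1). The tensor rank $\mathrm{trk}(T)$ is the least $r$ such that $T$ is a sum of $r$ simple tensors. For a linear map $\phi:V\to\mathrm{Ten}(m,k)$ and a spanning set $S\subseteq V$ of ''simples'', set $\mu_\phi(v)=\mathrm{trk}(\phi(v))$, $\mu_\phi(X)=\max\{\mu_\phi(x):x\in X\}$ for $X\subseteq V$, and define the potency $\mathrm{Pot}(\phi)=\mu_\phi(V)/\mu_\phi(S)$. *)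

(* Defs.v *)
From HB Require Import structures.
From mathcomp Require Import all_boot all_order all_algebra all_field.
From Stdlib Require Import ClassicalEpsilon.
Set Implicit Arguments. Unset Strict Implicit. Unset Printing Implicit Defensive.
Import Order.TTheory GRing.Theory Num.Theory.
Local Open Scope ring_scope.

(* Ten(n,d) = F^n (x) ... (x) F^n (d factors), realised as the F-vector space
   of functions from multi-indices (i_1,...,i_d) in [0,n)^d to F; the
   coordinate tensor of v_1 (x) ... (x) v_d at (i_1,..,i_d) is
   v_1(i_1) * ... * v_d(i_d). *)
Definition Ten (F : fieldType) (n d : nat) := {ffun d.-tuple 'I_n -> F^o}.

Definition simple_tensor (F : fieldType) (n d : nat) (v : 'I_d -> 'rV[F]_n)
  : Ten F n d :=
  [ffun t : d.-tuple 'I_n => \prod_(i < d) v i 0 (tnth t i)].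

Definition rank_le (F : fieldType) (n d : nat) (T : Ten F n d) (r : nat) : Prop :=
  exists vs : 'I_r -> 'I_d -> 'rV[F]_n, T = \sum_(j < r) simple_tensor (vs j).

(* least / greatest element of a set of naturals (classical choice;
   meaningful when it exists). *)
Definition least_nat (P : nat -> Prop) : nat :=
  epsilon (inhabits 0%N) (fun a => P a /\ forall b, P b -> (a <= b)%N).
Definition greatest_nat (P : nat -> Prop) : nat :=
  epsilon (inhabits 0%N) (fun a => P a /\ forall b, P b -> (b <= a)%N).

Definition trk (F : fieldType) (n d : nat) (T : Ten F n d) : nat :=
  least_nat (rank_le T).

Definition mu (F : fieldType) (n d m k : nat) (phi : Ten F n d -> Ten F m k)
  (X : Ten F n d -> Prop) : nat :=
  greatest_nat (fun a => exists2 x, X x & a = trk (phi x)).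

Definition is_simple (F : fieldType) (n d : nat) (T : Ten F n d) : Prop :=
  exists v : 'I_d -> 'rV[F]_n, T = simple_tensor v.

Definition potency (F : fieldType) (n d m k : nat)
  (phi : Ten F n d -> Ten F m k) : rat :=
  (mu phi (fun _ => True))%:R / (mu phi (@is_simple F n d))%:R.

(* Main.v *)
Require Import Defs.
From HB Require Import structures.
From mathcomp Require Import all_boot all_order all_algebra all_field.
From mathcomp Require Import boolp classical_sets functions filter.
From mathcomp Require Import ring zify.
From Stdlib Require ClassicalEpsilon.
Set Implicit Arguments.
Unset Strict Implicit.
Unset Printing Implicit Defensive.
Import Order.TTheory GRing.Theory Num.Theory.
Local Open Scope ring_scope.

(** Let [r] be the largest rank of [phi] on simple tensors. Over a field [L]
    containing [F] and [n * d] independent indeterminates [x_{i,y}], the generic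
    value [phi (x_1 (x) ... (x) x_d)] is still a sum of [r] products
    [w_1 (x) ... (x) w_k]: such an [L] is an iterated ultrapower of [F], to which
    the hypothesis on [phi] transfers, and from which rank bounds on tensors over
    [F] transfer back. In characteristic zero the partial derivatives with
    respect to the [x_{i,y}] extend to derivations of [L]. Applying to the
    generic identity one derivation [D_{i,t_i}] for each argument [i] gives [phi]
    on the basis tensor [t], and the Leibniz rule splits the right-hand side into
    [r * k ^ d] terms, one for each distribution of the [d] arguments among the
    [k] factors. In each term some factor receives at least [d / k] arguments;
    expanding in coordinates only the arguments received by the others, the term
    contributes rank at most [n ^ floor ((k - 1) d / k)]. *)

(** * Ultrapowers *)

Section Ultrapower.
Variables (K : fieldType) (U : set_system nat) (FU : UltraFilter U).

Definition null_fun : {pred nat -> K} :=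
  fun f => `[< U (fun i => f i = 0) >].

Lemma null_fun_idealr_closed : idealr_closed null_fun.
Proof.
split.
- by apply/asboolP; apply: filterS filterT.
- apply/asboolP => U10; have [i /eqP] := filter_ex U10.
  by rewrite oner_eq0.
- move=> a f g /asboolP Uf /asboolP Ug; apply/asboolP.
  apply: filterS2 Uf Ug => i fi0 gi0.
  by have -> : (a * f + g) i = a i * f i + g i by []; rewrite fi0 gi0 mulr0 addr0.
Qed.

HB.instance Definition _ :=
  isIdealr.Build (nat -> K) null_fun null_fun_idealr_closed.

Definition ultrapower := {ideal_quot null_fun}.

HB.instance Definition _ := GRing.ComNzRing.on ultrapower.

Definition ultracls : (nat -> K) -> ultrapower := \pi_(ultrapower)%qT.

Lemma ultracls_is_zmod_morphism : zmod_morphism ultracls.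
Proof. by move=> f g; rewrite /ultracls rmorphB. Qed.

Lemma ultracls_is_monoid_morphism : monoid_morphism ultracls.
Proof. by split=> [|f g]; rewrite /ultracls ?rmorph1 ?rmorphM. Qed.

HB.instance Definition _ :=
  GRing.isZmodMorphism.Build (nat -> K) ultrapower ultracls
    ultracls_is_zmod_morphism.
HB.instance Definition _ :=
  GRing.isMonoidMorphism.Build (nat -> K) ultrapower ultracls
    ultracls_is_monoid_morphism.

Lemma ultracls_surj (a : ultrapower) : exists f, ultracls f = a.
Proof. by exists (repr a); rewrite /ultracls reprK. Qed.

Lemma ultracls_eq0 f : ultracls f = 0 <-> U (fun i => f i = 0).
Proof.
have -> : ultracls f = 0 <-> (f \in null_fun).
  rewrite -[f in f \in _]subr0 Quotient.idealrBE.
  rewrite -[0 in X in X <-> _](rmorph0 ultracls).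
  by split=> [/eqP|/eqP].
by split=> /asboolP.
Qed.

Definition ultrainv (a : ultrapower) : ultrapower :=
  ultracls (fun i => (repr a i)^-1).

(** The ultrafilter contains the zero set of a representative or its complement. The first would
    make the class zero, so pointwise inversion works on a set of the filter. *)
Lemma ultra_mulVf a : a != 0 -> ultrainv a * a = 1.
Proof.
move=> a0; rewrite -[X in _ * X]reprK -/(ultracls (repr a)) -rmorphM.
apply/eqP; rewrite -subr_eq0 -(rmorph1 ultracls) -rmorphB; apply/eqP.
apply/ultracls_eq0.
have [U0|U1] := in_ultra_setVsetC (fun i => repr a i = 0) FU.
  case/eqP: a0; rewrite -[a]reprK; exact/ultracls_eq0.
apply: filterS U1 => i /eqP ai.
have -> : ((fun i : nat => (repr a i)^-1) * repr a - 1) i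
  = (repr a i)^-1 * repr a i - 1 by [].
by rewrite mulVf ?subrr.
Qed.

Lemma ultra_invr0 : ultrainv 0 = 0.
Proof.
apply/ultracls_eq0; have /ultracls_eq0 : ultracls (repr (0 : ultrapower)) = 0.
  by rewrite /ultracls reprK.
by apply: filterS => i ->; rewrite invr0.
Qed.

HB.instance Definition _ :=
  GRing.ComNzRing_isField.Build ultrapower ultra_mulVf ultra_invr0.

End Ultrapower.

(** [U] refines the cofinite filter on [nat]. Its sets are nonempty, so finitely many identities
    valid in [L] hold at a common index. They are also infinite, so in characteristic zero the class
    of the sequence [i%:R] is transcendental over the constants. *)
Lemma ultrapower_extension (K : fieldType) : [pchar K] =i pred0 ->
  exists (L : fieldType) (cls : {rmorphism (nat -> K) -> L}),
  [/\ forall a, exists f, cls f = a,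
      forall (I : finType) (f : I -> nat -> K), (forall i, cls (f i) = 0) ->
        exists p, forall i, f i p = 0
    & forall p : {poly K}, cls (fun i => p.[i%:R]) = 0 -> p = 0].
Proof.
move=> charK.
have [U [UU leU]] := ultraFilterLemma (T := nat) (F := eventually) _.
exists (ultrapower K UU), (@ultracls K U UU); split.
- exact: ultracls_surj.
- move=> I f f0.
  have /filter_ex[p fp] : U (fun p => forall i, f i p = 0).
    by apply: filter_forall => i; apply/ultracls_eq0/f0.
  by exists p.
- move=> p /ultracls_eq0 Up0; apply/eqP/negP => /negP p0.
  have infU m : U (fun i => (m <= i)%N).
    by apply: leU; exists m.
  have [s [us rs ss]] : exists s : seq nat,
      [/\ uniq s, all (fun i => root p i%:R) s & size s = size p].
    elim: (size p) => [|k [s [us rs ss]]]; first by exists [::].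
    (* Exceeding the sum of the indices found so far makes [i] a new one. *)
    have /filter_ex[i [pi0 si]] :
        U (fun i => p.[i%:R] = 0 /\ (\sum_(j <- s) j < i)%N).
      exact: filterI Up0 (infU _).
    exists (i :: s); split => /=; last by rewrite ss.
      rewrite us andbT; apply/negP => si'.
      by move: si; rewrite (big_rem i si') /= ltnNge leq_addr.
    by rewrite rs andbT; apply/eqP.
  suff: (size [seq (i%:R : K) | i <- s] < size p)%N by rewrite size_map ss ltnn.
  apply: max_poly_roots => //; first by rewrite all_map.
  rewrite map_inj_uniq // => i j /eqP.
  wlog ij : i j / (i <= j)%N.
    by move=> H; case/orP: (leq_total i j) => [/H//|/H Hx]; rewrite eq_sym => /Hx.
  rewrite eq_sym -subr_eq0 -natrB // => /eqP ji0.
  apply/eqP; rewrite eqn_leq ij -subn_eq0.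
  by have /pcharf0P <- := charK; apply/eqP.
Qed.

(** * Extension of derivations *)

Section SubringGen.
Variable A : nzRingType.
Implicit Types (X Y : set A) (a b : A) (p q : {poly A}).

Inductive subring_gen X : A -> Prop :=
| gen_in a : X a -> subring_gen X a
| gen_1 : subring_gen X 1
| gen_B a b : subring_gen X a -> subring_gen X b -> subring_gen X (a - b)
| gen_M a b : subring_gen X a -> subring_gen X b -> subring_gen X (a * b).

Lemma gen_0 X : subring_gen X 0.
Proof. by rewrite -(subrr 1); apply: gen_B; apply: gen_1. Qed.

Lemma gen_D X a b : subring_gen X a -> subring_gen X b -> subring_gen X (a + b).
Proof.
move=> Ha Hb; rewrite -[b]opprK -[- b]sub0r.
by do 2!apply: gen_B => //; apply: gen_0.
Qed.

Lemma gen_Mn X a n : subring_gen X a -> subring_gen X (a *+ n).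
Proof.
move=> Ha; elim: n => [|n IH]; first by rewrite mulr0n; apply: gen_0.
by rewrite mulrS; apply: gen_D.
Qed.

Lemma gen_mono X Y a : (X `<=` Y)%classic -> subring_gen X a -> subring_gen Y a.
Proof.
move=> XY; elim=> {a} [a /XY Ya||a b _ + _|a b _ + _].
- exact: gen_in.
- exact: gen_1.
- exact: gen_B.
- exact: gen_M.
Qed.

Definition coefs_in X p := forall i, subring_gen X p`_i.

Lemma coefs_inC X a : subring_gen X a -> coefs_in X a%:P.
Proof. by move=> Ha i; rewrite coefC; case: eqP => // _; apply: gen_0. Qed.

Lemma coefs_inX X : coefs_in X 'X.
Proof. by move=> i; rewrite coefX; case: eqP => _; [apply: gen_1|apply: gen_0]. Qed.

Lemma coefs_inB X p q : coefs_in X p -> coefs_in X q -> coefs_in X (p - q).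
Proof. by move=> Hp Hq i; rewrite coefB; apply: gen_B. Qed.

Lemma coefs_inM X p q : coefs_in X p -> coefs_in X q -> coefs_in X (p * q).
Proof.
move=> Hp Hq i; rewrite coefM.
by elim/big_ind: _ => [|a b|j _]; [apply: gen_0|apply: gen_D|apply: gen_M].
Qed.

Lemma coefs_inXn X n : coefs_in X 'X^n.
Proof.
elim: n => [|n IH]; first by rewrite expr0; apply: coefs_inC; apply: gen_1.
by rewrite exprS; apply: coefs_inM => //; apply: coefs_inX.
Qed.

End SubringGen.

Lemma gen_adjoin (A : comNzRingType) (X : set A) (x a : A) :
  subring_gen (X `|` [set x])%classic a ->
  exists2 p, coefs_in X p & a = p.[x].
Proof.
elim=> {a} [a [Xa|->]||a b _ [p Hp ->] _ [q Hq ->]|a b _ [p Hp ->] _ [q Hq ->]].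
- by exists a%:P; rewrite ?hornerC //; apply/coefs_inC/gen_in.
- by exists 'X; rewrite ?hornerX //; apply: coefs_inX.
- by exists 1%:P; rewrite ?hornerC //; apply/coefs_inC/gen_1.
- by exists (p - q); rewrite ?hornerE //; apply: coefs_inB.
- by exists (p * q); rewrite ?hornerM //; apply: coefs_inM.
Qed.

(** A pair [(a, b)] stands for [a + b eps] with [eps ^ 2 = 0]. A map [D] is a derivation exactly
    when its graph, the set of all [(a, D a)], is a subring of the dual numbers; extending
    derivations thus becomes enlarging subrings. *)
Definition dual (R : comNzRingType) : Type := (R * R)%type.

Section DualNumbers.
Variable R : comNzRingType.
Implicit Types u v w : dual R.

HB.instance Definition _ := GRing.Zmodule.copy (dual R) (R * R)%type.

Definition dual_mul u v : dual R := (u.1 * v.1, u.1 * v.2 + u.2 * v.1).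

Lemma dual_mulA : associative dual_mul.
Proof. by move=> u v w; congr pair => /=; ring. Qed.
Lemma dual_mulC : commutative dual_mul.
Proof. by move=> u v; congr pair => /=; ring. Qed.
Lemma dual_mul1 : left_id ((1, 0) : dual R) dual_mul.
Proof. by case=> a b; congr pair => /=; ring. Qed.
Lemma dual_mulDl : left_distributive dual_mul +%R.
Proof. by move=> u v w; congr pair => /=; ring. Qed.
Lemma dual_1neq0 : ((1, 0) : dual R) != 0.
Proof. by apply/eqP => -[/eqP]; rewrite oner_eq0. Qed.

HB.instance Definition _ := GRing.Zmodule_isComNzRing.Build (dual R)
  dual_mulA dual_mulC dual_mul1 dual_mulDl dual_1neq0.

Lemma dualM1 u v : (u * v).1 = u.1 * v.1. Proof. by []. Qed.
Lemma dualM2 u v : (u * v).2 = u.1 * v.2 + u.2 * v.1. Proof. by []. Qed.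
Lemma dualD1 u v : (u + v).1 = u.1 + v.1. Proof. by []. Qed.
Lemma dualD2 u v : (u + v).2 = u.2 + v.2. Proof. by []. Qed.
Lemma dualMn1 u n : (u *+ n).1 = u.1 *+ n.
Proof. by elim: n => // n IH; rewrite !mulrS dualD1 IH. Qed.

Lemma dual_horner1 (p : {poly dual R}) u v :
  u.1 = v.1 -> p.[u].1 = p.[v].1.
Proof.
move=> uv; elim/poly_ind: p => [|p c IH]; first by rewrite !horner0.
by rewrite !hornerE !dualD1 !dualM1 IH uv.
Qed.

(** The first-order Taylor expansion is exact because [eps ^ 2 = 0]; it determines the Newton step
    below. *)
Lemma dual_taylor (p : {poly dual R}) a s :
  p.[(a, s)].2 = p.[(a, 0)].2 + s * p^`().[(a, 0)].1.
Proof.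
elim/poly_ind: p => [|p c IH]; first by rewrite deriv0 !horner0 /=; ring.
rewrite derivD derivM derivX derivC !hornerE !(dualD1, dualD2, dualM1, dualM2) IH.
by rewrite (@dual_horner1 p (a, s) (a, 0)) //=; ring.
Qed.

End DualNumbers.

Definition derivation (R : nzRingType) (D : R -> R) :=
  (forall a b, D (a + b) = D a + D b) /\
  (forall a b, D (a * b) = D a * b + a * D b).

Lemma derivation0 (R : nzRingType) (D : R -> R) : derivation D -> D 0 = 0.
Proof. by case=> DD _; apply: (addrI (D 0)); rewrite -DD !addr0. Qed.

Lemma derivationN (R : nzRingType) (D : R -> R) a :
  derivation D -> D (- a) = - D a.
Proof.
by move=> derD; apply: (addrI (D a)); rewrite -derD.1 !subrr derivation0.
Qed.

Lemma derivation1 (R : nzRingType) (D : R -> R) : derivation D -> D 1 = 0.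
Proof.
by case=> _ DM; apply: (addrI (D 1)); rewrite addr0 -{3}[1]mulr1 DM mulr1 mul1r.
Qed.

Section DerivationExtension.
Variables (L : fieldType) (charL : [pchar L] =i pred0).
Implicit Types (X : set (dual L)) (p : {poly dual L}) (a b : dual L).

(* [functional X]: the subring generated by [X] is the graph of a map, which
   is then a derivation on its domain. *)
Definition functional X := forall a, subring_gen X a -> a.1 = 0 -> a = 0.

(* If [t] is transcendental any lift works. Otherwise one Newton step from [t]
   finds a root [u] of a nonzero [f] of minimal size with root [t]: the
   derivative of [f] does not vanish at [t] in characteristic zero, and
   pseudo-division by [f] then handles every other [p]. *)
Lemma root_lift X (t : L) : functional X ->
  exists2 u : dual L, u.1 = t &
    forall p, coefs_in X p -> p.[u].1 = 0 -> p.[u] = 0.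
Proof.
move=> FX; pose t0 : dual L := (t, 0).
have [ex|nex] := pselect (exists n, `[< exists p,
    [/\ p != 0, coefs_in X p, p.[t0].1 = 0 & size p = n] >]); last first.
  exists t0 => // p Hp pt; case: (eqVneq p 0) => [->|p0]; first exact: horner0.
  by case: nex; exists (size p); apply/asboolP; exists p.
have [n /asboolP[f [f0 Hf ft sf]] nmin] := ex_minnP ex.
have fmin p : coefs_in X p -> p.[t0].1 = 0 -> (size p < size f)%N -> p = 0.
  move=> Hp pt; rewrite sf ltnNge => lt; case: (eqVneq p 0) => // p0.
  by case/negP: lt; apply: nmin; apply/asboolP; exists p.
have lc0 : (lead_coef f).1 != 0.
  by apply/eqP => /FX /eqP; rewrite lead_coef_eq0 (negPf f0) => /(_ (Hf _)).
have sf1 : (1 < size f)%N.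
  rewrite ltnNge; apply/negP => /size1_polyC fE.
  case/negP: lc0; rewrite fE lead_coefC; move: ft; rewrite {1}fE hornerC => ->.
  exact: eqxx.
(* Otherwise minimality of [f] makes its derivative the zero polynomial, whose top coefficient is
   [(size f).-1] times the leading coefficient of [f]. *)
have f't : f^`().[t0].1 != 0.
  apply/eqP => /fmin; rewrite lt_size_deriv // => f'0.
  have /polyP/(_ (size f).-2) : f^`() = 0.
    by apply: f'0 => // i; rewrite coef_deriv; apply: gen_Mn.
  rewrite coef_deriv coef0 prednK -?lead_coefE; last by rewrite -subn1 subn_gt0.
  move=> /(congr1 (fun a => a.1)); rewrite dualMn1 => /eqP.
  rewrite -mulr_natl mulf_eq0 (negPf lc0) orbF.
  have /pcharf0P -> := charL.
  by rewrite -subn1 subn_eq0 leqNgt sf1.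
pose s := - f.[t0].2 / f^`().[t0].1.
exists ((t, s) : dual L) => // p.
set u : dual L := (t, s).
have fu : f.[u] = 0.
  have f1 : f.[u].1 = 0 by rewrite (@dual_horner1 _ f u t0).
  have f2 : f.[u].2 = 0 by rewrite dual_taylor divfK // subrr.
  by move: f1 f2; case: f.[u] => x y /= -> ->.
have [m] := ubnP (size p); elim: m p => // m IH p pm Hp pu.
case: (eqVneq p 0) => [->|p0]; first exact: horner0.
have pt : p.[t0].1 = 0 by rewrite (@dual_horner1 _ p t0 u).
have fp : (size f <= size p)%N.
  by rewrite leqNgt; apply: contraNN p0 => /(fmin _ Hp pt) ->.
have sp : (0 < size p)%N by rewrite size_poly_gt0.
pose k := (size p - size f)%N.
pose r := (lead_coef f)%:P * p - (lead_coef p)%:P * (f * 'X^k).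
have rE : r.[u] = lead_coef f * p.[u].
  by rewrite /r hornerD hornerN !hornerM !hornerC fu mul0r mulr0 subr0.
have /IH : (size r < m)%N.
  apply: leq_ltn_trans (_ : ((size p).-1 < m)%N); last first.
    by rewrite prednK // -ltnS.
  apply/leq_sizeP => j jp; rewrite coefB !coefCM coefMXn ltnNge.
  have -> /= : (k <= j)%N.
    apply: leq_trans jp; rewrite /k -subn1 leq_sub2l //.
    exact: leq_trans sf1.
  move: jp; rewrite leq_eqVlt => /predU1P[<-|].
    have -> : ((size p).-1 - k)%N = (size f).-1.
      by rewrite /k -subn1 -subnDA addnC subnDA subKn // subn1.
    by rewrite -!lead_coefE mulrC subrr.
  rewrite prednK // => pj; rewrite [p`_j]nth_default // [f`_ _]nth_default.
    by rewrite !mulr0 subrr.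
  by rewrite leq_subRL; [rewrite /k subnK|apply: leq_trans (leq_subr _ _) pj].
have Hr : coefs_in X r.
  apply: coefs_inB; apply: coefs_inM => //; try exact/coefs_inC/Hf.
    exact/coefs_inC/Hp.
  by apply: coefs_inM => //; apply: coefs_inXn.
move=> /(_ Hr); rewrite rE dualM1 pu mulr0 => /(_ erefl).
move: pu; case: (p.[u]) => x y /= -> /(congr1 (fun a => a.2)) /eqP.
by rewrite dualM2 /= mulr0 addr0 mulf_eq0 (negPf lc0) => /eqP ->.
Qed.

(** Zorn's lemma enlarges [X] to a maximal functional set. Lifting roots shows that every [t] in [L]
    is a first coordinate of its subring, which is therefore the graph of a map on all of [L];
    closure under sums and products gives the derivation laws. *)
Lemma extend_functional X : functional X ->
  exists2 D, derivation D & forall a, X a -> D a.1 = a.2.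
Proof.
move=> FX; have [Y [FY maxY]] : exists Y, functional (X `|` Y)%classic /\
    forall B, (Y `<` B)%classic -> ~ functional (X `|` B)%classic.
  apply: (@Zorn_bigcup _ (fun Y => functional (X `|` Y)%classic)).
  move=> C CF totC a Ca a0.
  (* Only finitely many generators occur in [a], and a chain puts them in a single member. The left
     case is for elements built from [X] alone, as when the chain is empty. *)
  suff [Xa|[Z CZ Za]] : subring_gen X a \/
      exists2 Z, C Z & subring_gen (X `|` Z)%classic a.
  - exact: FX.
  - exact: CF Za a0.
  have merge b c : subring_gen X b \/
      (exists2 Z, C Z & subring_gen (X `|` Z)%classic b) ->
    subring_gen X c \/ (exists2 Z, C Z & subring_gen (X `|` Z)%classic c) ->
    (subring_gen X b /\ subring_gen X c) \/ (exists2 Z, C Z &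
      subring_gen (X `|` Z)%classic b /\ subring_gen (X `|` Z)%classic c).
    have weak Z d : subring_gen X d -> subring_gen (X `|` Z)%classic d.
      by apply: gen_mono => ? ?; left.
    case=> [Xb|[Z CZ Zb]] [Xc|[Z' CZ' Zc]].
    - by left.
    - by right; exists Z' => //; split=> //; apply: weak.
    - by right; exists Z => //; split=> //; apply: weak.
    - right; case: (totC _ _ CZ CZ') => ZZ.
        by exists Z' => //; split=> //; apply: gen_mono Zb; apply: setUS.
      by exists Z => //; split=> //; apply: gen_mono Zc; apply: setUS.
  elim: Ca => {a a0} [a [Xa|[Z CZ Za]]||b c _ IHb _ IHc|b c _ IHb _ IHc].
  - by left; apply: gen_in.
  - by right; exists Z => //; apply: gen_in; right.
  - by left; apply: gen_1.
  - case: (merge _ _ IHb IHc) => [[? ?]|[Z CZ [? ?]]]; first by left; apply: gen_B.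
    by right; exists Z => //; apply: gen_B.
  - case: (merge _ _ IHb IHc) => [[? ?]|[Z CZ [? ?]]]; first by left; apply: gen_M.
    by right; exists Z => //; apply: gen_M.
set G := subring_gen (X `|` Y)%classic.
have totalG t : exists y, G (t, y).
  have [u <- Hu] := root_lift t FY; exists u.2; rewrite -surjective_pairing.
  have FYu : functional (X `|` (Y `|` [set u]))%classic.
    by move=> a; rewrite setUA => /gen_adjoin[p Hp ->]; apply: Hu.
  have [Yu|Yu] := pselect (Y u); first by apply: gen_in; right.
  case: (maxY (Y `|` [set u])%classic) => //; split; first exact: subsetUl.
  by move=> /(_ u)H; apply/Yu/H; right.
have [D GD] := choice totalG.
have uniqG t y : G (t, y) -> y = D t.
  move=> Gy; have := FY _ (gen_B Gy (GD t)); rewrite /= subrr => /(_ erefl).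
  by move=> /(congr1 (fun a => a.2)) /eqP; rewrite /= subr_eq0 => /eqP.
exists D; first split=> [a b|a b].
- by symmetry; apply: uniqG; apply: gen_D (GD a) (GD b).
- symmetry; apply: uniqG; have := gen_M (GD a) (GD b).
  by rewrite /GRing.mul /= /dual_mul /= addrC.
- by case=> t y Xa; symmetry; apply: uniqG; apply: gen_in; left.
Qed.

End DerivationExtension.

(** The hypothesis on [p] says that [t] is transcendental over the image of [j], so no polynomial
    relation restricts the value [s] prescribed at [t]. *)
Lemma extend_derivation (K L : fieldType) (j : {rmorphism K -> L})
    (d : K -> K) (t s : L) :
  [pchar L] =i pred0 -> derivation d ->
  (forall p : {poly K}, (map_poly j p).[t] = 0 -> p = 0) ->
  exists D : L -> L,
    [/\ derivation D, forall a, D (j a) = j (d a) & D t = s].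
Proof.
move=> charL derd trt.
pose lift a : dual L := (j a, j (d a)).
have liftB : zmod_morphism lift.
  by move=> a b; rewrite /lift derd.1 (derivationN _ derd) !rmorphB.
have liftM : monoid_morphism lift.
  split=> [|a b]; first by rewrite /lift (derivation1 derd) rmorph0 rmorph1.
  by rewrite /lift derd.2 rmorphD !rmorphM addrC.
pose lm : {rmorphism K -> dual L} := HB.pack lift
  (GRing.isZmodMorphism.Build _ _ _ liftB)
  (GRing.isMonoidMorphism.Build _ _ _ liftM).
pose u : dual L := (t, s).
pose X := (range lift `|` [set u])%classic.
have FX : functional X.
  move=> a Xa a0.
  have {Xa} [q aq] : exists q, a = (map_poly lm q).[u].
    elim: Xa => {a a0} [a [[c _ <-]|->]||a b _ [p ->] _ [q ->]|
                        a b _ [p ->] _ [q ->]].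
    - by exists c%:P; rewrite map_polyC hornerC.
    - by exists 'X; rewrite map_polyX hornerX.
    - by exists 1; rewrite rmorph1 hornerC.
    - by exists (p - q); rewrite rmorphB hornerE hornerN.
    - by exists (p * q); rewrite rmorphM hornerM.
  suff q0 : q = 0 by rewrite aq q0 rmorph0 horner0.
  apply: trt; rewrite -{}a0 {}aq; elim/poly_ind: q => [|p c IH].
    by rewrite !rmorph0 !horner0.
  rewrite !(rmorphD, rmorphM) /= !map_polyX !map_polyC !hornerE /= IH.
  by rewrite (map_polyX lm) (map_polyC lm) hornerX hornerC.
have [D derD DX] := extend_functional charL FX; exists D; split => //.
- by move=> a; apply: (DX (lift a)); left; exists a.
- by apply: (DX u); right.
Qed.

(** * Generic points *)

Definition sum_of_products (L : nzRingType) (m k r : nat)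
    (G : k.-tuple 'I_m -> L) :=
  exists w : 'I_r -> 'I_k -> 'I_m -> L,
    forall l, G l = \sum_(j < r) \prod_(a < k) w j a (tnth l a).

(** When [c t l] are the coordinates of a linear map on the basis tensors, this is coordinate [l] of
    its value on the simple tensor of the vectors [v i]. *)
Definition multilinear (L : nzRingType) (n d m k : nat)
    (c : d.-tuple 'I_n -> k.-tuple 'I_m -> L) (v : 'I_d -> 'I_n -> L)
    (l : k.-tuple 'I_m) : L :=
  \sum_t (\prod_(i < d) v i (tnth t i)) * c t l.

(** Induction on [N]: each step passes to an ultrapower, which supplies one more element
    transcendental over the old field. The last two clauses carry the hypothesis up and rank bounds
    down. Values of [x] and [D] from index [N] on are arbitrary. *)
Lemma generic_extension (F : fieldType) (n d m k r N : nat)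
    (c : d.-tuple 'I_n -> k.-tuple 'I_m -> F) :
  [pchar F] =i pred0 ->
  (forall v, sum_of_products r (multilinear c v)) ->
  exists (L : fieldType) (j : {rmorphism F -> L}) (x : nat -> L)
    (D : nat -> L -> L),
  [/\ forall i, (i < N)%N -> derivation (D i) /\ (forall a, D i (j a) = 0),
      forall i i', (i < N)%N -> (i' < N)%N -> D i (x i') = (i == i')%:R,
      forall v, sum_of_products r (multilinear (fun t l => j (c t l)) v)
    & forall s T, sum_of_products (m := m) (k := k) s (fun l => j (T l)) ->
        sum_of_products s T].
Proof.
move=> charF Hc; elim: N => [|N [L [j [x [D [derD Dx HL desc]]]]]].
  by exists F, idfun, (fun=> 0), (fun=> id).
have charL : [pchar L] =i pred0 by move=> p; rewrite (fmorph_pchar j).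
have [L' [cls [surj common trans]]] := ultrapower_extension charL.
pose h a := cls (fun=> a).
have hB : zmod_morphism h by move=> a b; rewrite /h -rmorphB.
have hM : monoid_morphism h.
  by split=> [|a b]; rewrite /h -?rmorphM -1?(rmorph1 cls).
pose hm : {rmorphism L -> L'} := HB.pack h
  (GRing.isZmodMorphism.Build _ _ _ hB) (GRing.isMonoidMorphism.Build _ _ _ hM).
pose y := cls (fun i => i%:R).
have evaly (p : {poly L}) : (map_poly hm p).[y] = cls (fun i => p.[i%:R]).
  elim/poly_ind: p => [|p b IH].
    rewrite rmorph0 horner0 -(rmorph0 cls); congr (cls _).
    by apply/funext => i; rewrite horner0.
  rewrite rmorphD rmorphM /= (map_polyX hm) (map_polyC hm) hornerD hornerM
    hornerX hornerC IH -[X in _ + X]/(cls (fun=> b)) -rmorphM -rmorphD.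
  by congr (cls _); apply/funext => i; rewrite !hornerE.
have ytrans (p : {poly L}) : (map_poly hm p).[y] = 0 -> p = 0.
  by rewrite evaly; apply: trans.
have charL' : [pchar L'] =i pred0 by move=> p; rewrite (fmorph_pchar hm).
have der0 : derivation (fun _ : L => 0 : L).
  by split=> a b; rewrite ?addr0 // mul0r mulr0 addr0.
(* The derivation of index [N] kills the old field and sends [y] to 1; each earlier one is extended
   by the value 0 at [y]. *)
have /choice[D' D'P] i : exists D' : L' -> L', (i < N.+1)%N ->
    [/\ derivation D', forall a, D' (hm a) = hm (if i == N then 0 else D i a)
      & D' y = (i == N)%:R].
  case: eqP => [->|/eqP iN].
    have [D' [? ? ?]] := extend_derivation 1 charL' der0 ytrans.
    by exists D'.
  case: (ltnP i N) => [lt|ge]; last first.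
    by exists id; rewrite ltnS leq_eqVlt (negPf iN) /= ltnNge ge.
  have [D' [? ? ?]] := extend_derivation 0 charL' (derD _ lt).1 ytrans.
  by exists D'.
exists L', (hm \o j), (fun i => if i == N then y else hm (x i)), D'; split.
- move=> i lt; have [? Dh _] := D'P i lt; split=> // a.
  rewrite Dh; case: eqP => [_|/eqP iN]; first by rewrite rmorph0.
  have ltN : (i < N)%N by rewrite ltn_neqAle iN -ltnS.
  by rewrite (derD i ltN).2 rmorph0.
- move=> i i' lt lt'; have [_ Dh Dy] := D'P i lt.
  case: (eqVneq i' N) => [->|iN']; first by rewrite Dy.
  rewrite Dh; case: (eqVneq i N) => [->|iN].
    by rewrite rmorph0 eq_sym (negPf iN').
  by rewrite Dx ?rmorph_nat // ltn_neqAle ?iN ?iN' -ltnS.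
(* The entries of [v] are classes of sequences. The hypothesis at each index [p] yields factors, and
   their classes are the factors sought. *)
- move=> v; have [V vV] : exists V, forall i x, cls (V i x) = v i x.
    have /choice[V HV] ix : exists f, cls f = v ix.1 ix.2 by apply: surj.
    by exists (fun i x => V (i, x)) => i x0; rewrite HV.
  have /choice[W HW] p := HL (fun i x => V i x p).
  exists (fun b a x => cls (fun p => W p b a x)) => l.
  under [RHS]eq_bigr do rewrite -rmorph_prod.
  rewrite -rmorph_sum /multilinear /=.
  under eq_bigr => t _.
    under eq_bigr do rewrite -vV.
    rewrite -rmorph_prod -[h _]/(cls _) -rmorphM; over.
  rewrite -rmorph_sum; congr (cls _); apply/funext => p.
  transitivity (multilinear (fun t l => j (c t l)) (fun i x => V i x p) l).
    rewrite /multilinear fct_sumE; apply: eq_bigr => t _.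
    by rewrite -[LHS]/(_ * _) fct_prodE.
  by rewrite HW fct_sumE; apply: eq_bigr => b _; rewrite fct_prodE.
- move=> s T [w Hw]; apply: desc.
  have [W wW] : exists W, forall b a x, cls (W b a x) = w b a x.
    have /choice[W HW] q : exists f, cls f = w q.1.1 q.1.2 q.2 by apply: surj.
    by exists (fun b a x => W (b, a, x)) => b a x0; rewrite HW.
  (* The sequences [f l] have zero class. There are finitely many [l], so all vanish at one index
     [p], where the factors lie in the old field. *)
  pose f l := (fun _ : nat => j (T l)) -
    \sum_(b < s) \prod_(a < k) (W b a (tnth l a)).
  have [|p fp] := common _ f.
    move=> l; rewrite rmorphB -[X in X - _]/((hm \o j) (T l)) Hw.
    rewrite rmorph_sum; apply/eqP; rewrite subr_eq0; apply/eqP.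
    apply: eq_bigr => b _; rewrite rmorph_prod.
    by apply: eq_bigr => a _; rewrite wW.
  exists (fun b a x => W b a x p) => l; apply/eqP; rewrite -subr_eq0.
  rewrite -[X in _ == X](fp l) /f; apply/eqP.
  rewrite -[RHS]/(_ - _) fct_sumE; congr (_ - _).
  by apply: eq_bigr => b _; rewrite fct_prodE.
Qed.

(** * Leibniz rule and iterated derivations *)

Section Leibniz.
Variables (L : comNzRingType).
Implicit Types D : L -> L.

Lemma derivation_sum D (I : finType) (G : I -> L) : derivation D ->
  D (\sum_i G i) = \sum_i D (G i).
Proof.
move=> derD; elim/big_ind2: _ => // [|a b a' b' <- <-].
  exact: derivation0.
by case: derD => ->.
Qed.

Lemma derivation_prod D (I : finType) (G : I -> L) : derivation D ->
  D (\prod_i G i) = \sum_b \prod_i (if i == b then D (G i) else G i).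
Proof.
move=> derD; have := index_enum_uniq I.
elim: (index_enum I) => [|b s IH] /=.
  by rewrite !big_nil (derivation1 derD).
move=> /andP[bs us]; rewrite !big_cons eqxx derD.2 IH //; congr (_ * _ + _).
  apply: eq_big_seq => i si; rewrite ifN //.
  by apply: contraNneq bs => <-.
rewrite mulr_sumr; apply: eq_big_seq => i si; rewrite big_cons ifN //.
by apply: contraNneq bs => ->.
Qed.

Fixpoint iter_der n (D : nat -> 'I_n -> L -> L) e (t : nat -> 'I_n) (a : L) :=
  if e is e'.+1 then D e' (t e') (iter_der D e' t a) else a.

(* By the Leibniz rule a product of [k] factors differentiated [e] times is the
   sum over the [k ^ e] ways of distributing the derivations among the factors;
   [f j i] is the factor that receives the [i]-th derivation. *)
Lemma iter_der_sum_of_products n d m k r (D : nat -> 'I_n -> L -> L)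
    (w : 'I_r -> 'I_k -> 'I_m -> L) (a0 : 'I_k) e :
  (forall i x, (i < d)%N -> derivation (D i x)) -> (e <= d)%N ->
  exists (J : finType) (f : J -> nat -> 'I_k)
    (u : J -> 'I_k -> (nat -> 'I_n) -> 'I_m -> L),
  [/\ #|J| = (r * k ^ e)%N,
      forall j a t t', (forall i, (i < e)%N -> f j i = a -> t i = t' i) ->
        u j a t =1 u j a t'
    & forall t (l : k.-tuple 'I_m),
        iter_der D e t (\sum_(j < r) \prod_(a < k) w j a (tnth l a)) =
        \sum_j \prod_(a < k) u j a t (tnth l a)].
Proof.
move=> derD; elim: e => [_|e IH lt].
  exists 'I_r, (fun _ _ => a0), (fun j a _ => w j a).
  by split=> //; rewrite card_ord muln1.
have [J [f [u [cardJ dep uE]]]] := IH (ltnW lt).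
exists (J * 'I_k)%type, (fun jb i => if i == e then jb.2 else f jb.1 i),
  (fun jb a t x => if a == jb.2 then D e (t e) (u jb.1 a t x) else u jb.1 a t x).
split=> [|[j b] a t t' /= tt' x|t l].
- by rewrite card_prod card_ord cardJ expnSr mulnA.
- have -> : u j a t x = u j a t' x.
    apply: dep => i ie fi; apply: tt'; first exact: ltnW.
    by rewrite ltn_eqF.
  by case: eqP => // ab; rewrite (tt' e) // eqxx.
- rewrite /= uE (derivation_sum _ (derD e (t e) lt)).
  under [LHS]eq_bigr do rewrite (derivation_prod _ (derD e (t e) lt)).
  by rewrite pair_big.
Qed.

(** The derivations kill the coefficients [c], and those of index [i] act only on the [i]-th
    variable of each monomial. One derivation per argument thus extracts the coefficient of the
    monomial indexed by [t]. *)
Lemma iter_der_generic n d m k (D : nat -> 'I_n -> L -> L)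
    (x : nat -> 'I_n -> L) (c : d.-tuple 'I_n -> k.-tuple 'I_m -> L) :
  (forall i y, (i < d)%N -> derivation (D i y)) ->
  (forall i y t l, (i < d)%N -> D i y (c t l) = 0) ->
  (forall i i' y y', (i < d)%N -> (i' < d)%N ->
    D i y (x i' y') = ((i == i') && (y == y'))%:R) ->
  forall (t : d.-tuple 'I_n) l (t' : nat -> 'I_n),
    (forall i, t' (val i) = tnth t i) ->
  iter_der D d t' (multilinear c (fun i => x i) l) = c t l.
Proof.
move=> derD Dc Dx t l t' tt'.
(* The [i]-th factor of a monomial after [e] derivations: a Kronecker delta if already
   differentiated, the variable itself otherwise. *)
pose y e (t1 : d.-tuple 'I_n) (i : 'I_d) : L :=
  if (i < e)%N then (t' i == tnth t1 i)%:R else x i (tnth t1 i).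
have main e : (e <= d)%N ->
  iter_der D e t' (multilinear c (fun i => x i) l) =
  \sum_t1 (\prod_i y e t1 i) * c t1 l.
  elim: e => [_|e IH lt] //=; rewrite IH ?(ltnW lt) //.
  have der := derD e (t' e) lt.
  have Dnat b : D e (t' e) (nat_of_bool b)%:R = 0.
    by case: b; rewrite ?(derivation1 der) ?(derivation0 der).
  rewrite derivation_sum //; apply: eq_bigr => t1 _.
  rewrite der.2 Dc // mulr0 addr0 derivation_prod //; congr (_ * _).
  pose e0 := Ordinal lt.
  have Dy b : b != e0 -> D e (t' e) (y e t1 b) = 0.
    move=> be; rewrite /y; case: ltnP => // eb; rewrite Dx //.
    rewrite (_ : (e == b) = false) //.
    by apply: contraNF be => /eqP eb'; apply/eqP/val_inj.
  rewrite (bigD1 e0) //= [X in _ + X]big1 ?addr0 => [|b be]; last first.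
    by rewrite (bigD1 b) //= eqxx Dy // mul0r.
  apply: eq_bigr => i _; case: eqP => [->|/eqP ie].
    by rewrite /y /= ltnn ltnSn Dx // eqxx.
  rewrite /y ltnS [(i <= e)%N]leq_eqVlt.
  rewrite (_ : (val i == e) = false) //.
  by apply: contraNF ie => /eqP ie'; apply/eqP/val_inj.
rewrite main // (bigD1 t) //= [X in _ + X]big1 ?addr0 => [|t1 t1t].
  by rewrite big1 ?mul1r // => i _; rewrite /y ltn_ord tt' eqxx.
have [i ti] : exists i, tnth t1 i != tnth t i.
  apply/existsP; rewrite -negb_forall; apply: contraNN t1t => /forallP tt1.
  by apply/eqP/eq_from_tnth => i; apply/eqP.
by rewrite (bigD1 i) //= /y ltn_ord tt' eq_sym (negPf ti) !mul0r.
Qed.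
End Leibniz.

(** * Rank bounds *)

Section SumOfProducts.
Variables (L : comNzRingType) (m k : nat).
Implicit Types G : k.-tuple 'I_m -> L.

Lemma sum_of_products_fin (I : finType) (w : I -> 'I_k -> 'I_m -> L) G :
  (forall l, G l = \sum_i \prod_(a < k) w i a (tnth l a)) ->
  sum_of_products #|I| G.
Proof.
move=> Gw; exists (fun j => w (enum_val j)) => l.
by rewrite Gw (reindex (@enum_val I I)) //; apply/onW_bij/enum_val_bij.
Qed.

Lemma sum_of_products_leq (r s : nat) G : (0 < k)%N -> (r <= s)%N ->
  sum_of_products r G -> sum_of_products s G.
Proof.
move=> k0 rs [w Gw].
have cardE : s = #|{: 'I_r + 'I_(s - r)}| by rewrite card_sum !card_ord subnKC.
(* Pad with products of zeros, which vanish because they have at least one factor. *)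
rewrite cardE; apply: (@sum_of_products_fin _
  (fun jj a x => if jj is inl j then w j a x else 0)) => l.
rewrite Gw big_sumType /= [X in _ = _ + X]big1 ?addr0 // => j _.
by rewrite (bigD1 (Ordinal k0)) //= mul0r.
Qed.

Lemma sum_of_products_sum (I : finType) b (G : I -> k.-tuple 'I_m -> L) :
  (forall i, sum_of_products b (G i)) ->
  sum_of_products (#|I| * b) (fun l => \sum_i G i l).
Proof.
move=> /choice[w Gw].
have -> : (#|I| * b = #|{: I * 'I_b}|)%N by rewrite card_prod card_ord.
apply: (@sum_of_products_fin _ (fun ij => w ij.1 ij.2)) => l.
by rewrite -(pair_big xpredT xpredT (fun i j => \prod_(a < k) w i j a (tnth l a)))
  /=; apply: eq_bigr.
Qed.

Lemma sum_of_products_max G : (0 < k)%N -> sum_of_products (m ^ k) G.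
Proof.
move=> k0; have -> : (m ^ k = #|{: k.-tuple 'I_m}|)%N by rewrite card_tuple card_ord.
pose a0 := Ordinal k0.
apply: (@sum_of_products_fin _ (fun t a x =>
  (if a == a0 then G t else 1) * (x == tnth t a)%:R)) => l.
rewrite (bigD1 l) //= [X in _ + X]big1 ?addr0 => [|t tl].
  rewrite (bigD1 a0) //= !eqxx mulr1 big1 ?mulr1 // => a /negPf ->.
  by rewrite mul1r eqxx.
have [a la] : exists a, tnth l a != tnth t a.
  apply/existsP; rewrite -negb_forall; apply: contraNN tl => /forallP lt.
  by apply/eqP/eq_from_tnth => a; apply/esym/eqP.
by rewrite (bigD1 a) //= (negPf la) mulr0 mul0r.
Qed.

(* Expanding in coordinates every factor except [a0], the one that involves the
   largest number of the arguments, costs one product for each assignment of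
   the other arguments. *)
Lemma sum_of_products_split n d (f : 'I_d -> 'I_k)
    (u : 'I_k -> d.-tuple 'I_n -> 'I_m -> L) (T : d.-tuple 'I_n -> L) :
  (0 < n)%N ->
  (forall a t t', (forall i, f i = a -> tnth t i = tnth t' i) ->
    u a t =1 u a t') ->
  (0 < k)%N ->
  sum_of_products (n ^ (((k - 1) * d) %/ k))
    (fun l => \sum_t T t * \prod_(a < k) u a t (tnth l a)).
Proof.
move=> n0 dep k0; pose S a := [set i | f i == a].
have sumS : (\sum_a #|S a| = d)%N.
  under eq_bigr do rewrite cardsE -sum1_card.
  rewrite -[RHS](card_ord d) -sum1_card.
  by rewrite [RHS](partition_big f xpredT).
(* Pigeonhole: if every [k * #|S a|] were below [d], summing over the [k] factors would give
   [k * d < k * d]. *)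
have [a0 da0] : exists a0, (d <= k * #|S a0|)%N.
  apply/existsP; rewrite -[[exists _, _]]negbK negb_exists; apply/negP => /forallP H.
  have : (\sum_(a < k) (k * #|S a|).+1 <= \sum_(a < k) d)%N.
    by apply: leq_sum => a _; rewrite ltnNge.
  under eq_bigr do rewrite -addn1.
  rewrite big_split /= -big_distrr /= sumS !sum_nat_const card_ord muln1.
  by rewrite -[X in (_ <= X)%N]addn0 leq_add2l leqNgt k0.
pose Q := {ffun {i : 'I_d | i \notin S a0} -> 'I_n}.
have cardQ : #|{: Q}| = (n ^ (d - #|S a0|))%N.
  rewrite card_ffun card_ord card_sig; congr (_ ^ _)%N.
  rewrite -[X in (X - _)%N](card_ord d) -(cardC (mem (S a0))) addKn.
  by apply: eq_card => i; rewrite !inE.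
apply: (@sum_of_products_leq #|{: Q}|) => //.
  (* The choice of [a0] gives [(d - #|S a0|) * k <= (k - 1) * d], whence the floor in the
     exponent. *)
  rewrite cardQ leq_pexp2l // leq_divRL //.
  have : (#|S a0| <= d)%N by rewrite -[X in (_ <= X)%N](card_ord d) max_card.
  by move: da0; move: #|S a0| => z; nia.
pose p t : Q := [ffun i => tnth t (val i)].
pose t0 : d.-tuple 'I_n := [tuple Ordinal n0 | i < d].
pose rep q := odflt t0 [pick t | p t == q].
(* Factor [a0] absorbs the whole sum over the tuples restricting to [q]. The other factors depend
   only on [q] and are read at a representative. *)
apply: (@sum_of_products_fin _ (fun q a x =>
  if a == a0 then \sum_(t | p t == q) T t * u a0 t x else u a (rep q) x)) => l.
rewrite (partition_big p xpredT) //=; apply: eq_bigr => q _.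
rewrite (bigD1 a0) //= eqxx mulr_suml; apply: eq_bigr => t /eqP ptq.
rewrite (bigD1 a0) //= mulrA; congr (_ * _); apply: eq_bigr => a aa0.
rewrite (negPf aa0); apply: dep => i fi.
rewrite /rep; case: pickP => [t1 /eqP pt1|/(_ t)]; last by rewrite ptq eqxx.
have Si : i \notin S a0 by rewrite inE fi.
have /ffunP/(_ (exist _ i Si)) : p t = p t1 by rewrite ptq pt1.
by rewrite !ffunE.
Qed.
End SumOfProducts.

Lemma multilinear_rank_bound (F : fieldType) (n d m k r : nat)
    (c : d.-tuple 'I_n -> k.-tuple 'I_m -> F) (T : d.-tuple 'I_n -> F) :
  [pchar F] =i pred0 -> (0 < n)%N -> (0 < k)%N ->
  (forall v, sum_of_products r (multilinear c v)) ->
  sum_of_products (r * k ^ d * n ^ (((k - 1) * d) %/ k))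
    (fun l => \sum_t T t * c t l).
Proof.
move=> charF n0 k0 /(generic_extension (d * n) charF).
move=> [L [j [x [D [derD Dx HL]]]]]; apply.
have ltdn i (y : 'I_n) : (i < d)%N -> (i * n + y < d * n)%N.
  by move=> lt; have := ltn_ord y; nia.
(* Position [i * n + y] numbers the indeterminate for coordinate [y] of argument [i]. *)
pose X i (y : 'I_n) := x (i * n + y)%N.
pose DD i (y : 'I_n) := D (i * n + y)%N.
have derDD i y : (i < d)%N -> derivation (DD i y).
  by move=> lt; case: (derD _ (ltdn i y lt)).
have [w Xw] := HL (fun i => X i).
have [J [f [u [cardJ dep uE]]]] :=
  iter_der_sum_of_products w (Ordinal k0) derDD (leqnn d).
pose ext (t : d.-tuple 'I_n) i := nth (Ordinal n0) t i.
have extE t (i : 'I_d) : ext t i = tnth t i by rewrite /ext -tnth_nth.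
have cE t l : j (c t l) = \sum_b \prod_(a < k) u b a (ext t) (tnth l a).
  rewrite -uE -Xw; symmetry.
  apply: (@iter_der_generic _ n d m k DD X (fun t l => j (c t l))) => //.
  - by move=> i y t' l' lt; exact: (derD _ (ltdn i y lt)).2.
  - move=> i i' y y' lt lt'; rewrite /DD /X Dx ?ltdn //.
    congr (nat_of_bool _)%:R; apply/eqP/andP => [E|[/eqP -> /eqP ->]] //.
    have ii : i = i' by have := ltn_ord y; have := ltn_ord y'; nia.
    by split; apply/eqP => //; apply/val_inj; move: E; rewrite ii /=; lia.
  - exact: extE.
rewrite [X in sum_of_products _ X](_ : _ = fun l => \sum_b \sum_t
    j (T t) * \prod_(a < k) u b a (ext t) (tnth l a)); last first.
  apply/funext => l; rewrite rmorph_sum exchange_big; apply: eq_bigr => t _.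
  by rewrite rmorphM cE mulr_sumr.
rewrite -cardJ; apply: sum_of_products_sum => b.
apply: (@sum_of_products_split _ _ _ _ _ (fun i => f b i)
  (fun a t => u b a (ext t)) (fun t => j (T t))) => //.
move=> a t t' tt'; apply: dep => i lt fi.
by have := tt' (Ordinal lt) fi; rewrite -!extE.
Qed.

(** * Tensor rank, maximal rank and potency *)

Lemma rank_leP (F : fieldType) (m k r : nat) (T : Ten F m k) :
  rank_le T r <-> sum_of_products r (fun l => T l).
Proof.
split=> [[vs ->]|[w Tw]].
  exists (fun j a x => vs j a 0 x) => l; rewrite sum_ffunE.
  by apply: eq_bigr => j _; rewrite ffunE.
exists (fun j a => \row_x w j a x); apply/ffunP => l.
rewrite Tw sum_ffunE; apply: eq_bigr => j _; rewrite ffunE.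
by apply: eq_bigr => a _; rewrite mxE.
Qed.

Lemma rank_le_image (F : fieldType) (n d m k r : nat)
    (phi : {linear Ten F n d -> Ten F m k}) :
  [pchar F] =i pred0 -> (0 < n)%N -> (0 < k)%N ->
  (forall x, is_simple x -> rank_le (phi x) r) ->
  forall x, rank_le (phi x) (r * k ^ d * n ^ (((k - 1) * d) %/ k)).
Proof.
move=> charF n0 k0 simple_le.
pose e t : Ten F n d := [ffun t' => (t' == t)%:R].
have phiE (x : Ten F n d) l : phi x l = \sum_t x t * phi (e t) l.
  have {1}-> : x = \sum_t (x t : F) *: e t.
    apply/ffunP => t; rewrite sum_ffunE (bigD1 t) //= big1 ?addr0 => [|t' tt'].
      by rewrite !ffunE eqxx [RHS]mulr1.
    by rewrite !ffunE eq_sym (negPf tt') [LHS]mulr0.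
  by rewrite linear_sum sum_ffunE; apply: eq_bigr => t _; rewrite linearZ ffunE.
move=> x; apply/rank_leP.
rewrite (_ : (fun l => phi x l) = (fun l => \sum_t x t * phi (e t) l)); last first.
  by apply/funext => l; apply: phiE.
apply: (multilinear_rank_bound (c := fun t l => phi (e t) l)) => // v.
have /rank_leP : rank_le (phi (simple_tensor (fun i => \row_y v i y))) r.
  by apply: simple_le; exists (fun i => \row_y v i y).
congr sum_of_products; apply/funext => l; rewrite phiE.
apply: eq_bigr => t _; rewrite ffunE; congr (_ * _).
by apply: eq_bigr => i _; rewrite mxE.
Qed.

Lemma least_natP (P : nat -> Prop) : (exists a, P a) ->
  P (least_nat P) /\ forall b, P b -> (least_nat P <= b)%N.
Proof.
move=> [a Pa]; apply: (ClassicalEpsilon.epsilon_spec _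
  (fun a => P a /\ forall b, P b -> (a <= b)%N)).
have ex : exists a, `[< P a >] by exists a; apply/asboolP.
have [b /asboolP Pb bmin] := ex_minnP ex.
by exists b; split=> // b' Pb'; apply/bmin/asboolP.
Qed.

Lemma greatest_natP (P : nat -> Prop) N : (exists a, P a) ->
  (forall a, P a -> (a <= N)%N) ->
  P (greatest_nat P) /\ forall b, P b -> (b <= greatest_nat P)%N.
Proof.
move=> [a Pa] PN; apply: (ClassicalEpsilon.epsilon_spec _
  (fun a => P a /\ forall b, P b -> (b <= a)%N)).
have ex : exists a, `[< P a >] by exists a; apply/asboolP.
have PN' b : `[< P b >] -> (b <= N)%N by move=> /asboolP; apply: PN.
have [b /asboolP Pb bmax] := ex_maxnP ex PN'.
by exists b; split=> // b' Pb'; apply/bmax/asboolP.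
Qed.

Lemma trkP (F : fieldType) (m k : nat) (T : Ten F m k) : (0 < k)%N ->
  [/\ rank_le T (trk T), forall r, rank_le T r -> (trk T <= r)%N
    & (trk T <= m ^ k)%N].
Proof.
move=> k0; have max : rank_le T (m ^ k) by apply/rank_leP/sum_of_products_max.
have [le min] : rank_le T (trk T) /\ forall r, rank_le T r -> (trk T <= r)%N.
  by apply: least_natP; exists (m ^ k)%N.
by split=> //; apply: min.
Qed.

(** All ranks are at most [m ^ k], so the maximum defining [mu] is attained. *)
Lemma muP (F : fieldType) (n d m k : nat) (phi : Ten F n d -> Ten F m k)
    (X : Ten F n d -> Prop) : (0 < k)%N -> (exists x, X x) ->
  (exists2 x, X x & mu phi X = trk (phi x)) /\
  forall x, X x -> (trk (phi x) <= mu phi X)%N.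
Proof.
move=> k0 [x0 Xx0]; pose P a := exists2 x, X x & a = trk (phi x).
have [||[x Xx mx] max] := @greatest_natP P (m ^ k).
- by exists (trk (phi x0)), x0.
- by move=> _ [x _ ->]; have [] := trkP (phi x) k0.
- by split=> [|y Xy]; [exists x|apply: max; exists y].
Qed.

Theorem theorem1p7 (F : closedFieldType) (hF : [pchar F] =i pred0)
  (n m d k : nat) (hn : (1 <= n)%N) (hm : (1 <= m)%N) (hd : (1 <= d)%N)
  (hk : (1 <= k)%N)
  (phi : {linear Ten F n d -> Ten F m k}) (hphi : exists v, phi v != 0) :
  potency phi <= ((k ^ d) * n ^ (((k - 1) * d) %/ k))%:R.
Proof.
pose S := @is_simple F n d.
have [[x _ muV] _] := muP phi hk (ex_intro (fun _ => True) 0 I).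
have [|_ le_mu] := muP (X := S) phi hk.
  by exists (simple_tensor (fun=> 0)), (fun=> 0).
rewrite /potency muV -/S; move: (mu phi S) le_mu => r le_mu.
have le_r y : S y -> rank_le (phi y) r.
  move=> Sy; have [/rank_leP rk _ _] := trkP (phi y) hk.
  by apply/rank_leP; apply: sum_of_products_leq (le_mu y Sy) rk.
have [_ /(_ _ (rank_le_image hF hn hk le_r x)) le_trk _] := trkP (phi x) hk.
(* For [r = 0] the quotient is 0, by the convention that the inverse of 0 is 0. *)
have [->|r0] := posnP r; first by rewrite invr0 mulr0 ler0n.
rewrite ler_pdivrMr ?ltr0n // -natrM ler_nat.
by rewrite mulnC mulnA.
Qed.
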